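(* Let $f$ and $g$ be transcendental entire functions with $f\circ g=g\circ f$, where $g(z)=a f^{p}(z)+b$ for all $z\in\mathbb{C}$, with $a,b\in\mathbb{C}$, $p\in\mathbb{N}$, $a\neq 0,1$ and $|a|=1$. Let $f\in\mathcal{B}$. If $f$ is postsingularly bounded, then $g$ and $f\circ g$ are postsingularly bounded.
   Context: $\mathbb{N}=\{1,2,\dots\}$; $f^{n}$ denotes the $n$-th iterate of $f$ (with $f^0$ the identity). For a transcendental entire function $f:\mathbb{C}\to\mathbb{C}$: a critical value is a point $w\in\mathbb{C}$ such that $w=f(w_0)$ for some $w_0\in\mathbb{C}$ with $f'(w_0)=0$; an asymptotic value is a point $\zeta\in\mathbb{C}$ such that there is a curve $\Gamma$ tending to infinity with $f(z)\to\zeta$ as $z\to\infty$ along $\Gamma$. $\mathrm{Sing}(f^{-1})$ is the set of all critical values and asymptotic values of $f$ together with their finite limit points. $\mathcal{B}$ is the class of transcendental entire functions $f$ for which $\mathrm{Sing}(f^{-1})$ is bounded. The postsingular set of $f$ is $P(f)=\overline{\bigcup_{n\ge 0} f^{n}(\mathrm{Sing}(f^{-1}))}$ (closure in $\mathbb{C}$). $f$ is called postsingularly bounded if $P(f)$ is a bounded set. *)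

(* Defs.v *)
From Stdlib Require Export Reals.
From Coquelicot Require Export Coquelicot.
Open Scope C_scope.

Definition entire (f : C -> C) : Prop :=
  forall z : C, ex_derive (K := C_AbsRing) (V := C_NormedModule) f z.

Definition polynomial_function (f : C -> C) : Prop :=
  exists (n : nat) (c : nat -> C),
    forall z : C, f z = sum_n (fun k => c k * z ^ k) n.

Definition transcendental_entire (f : C -> C) : Prop :=
  entire f /\ ~ polynomial_function f.

Definition critical_value (f : C -> C) (w : C) : Prop :=
  exists w0 : C,
    is_derive (K := C_AbsRing) (V := C_NormedModule) f w0 (RtoC 0) /\ f w0 = w.

(* The curve is gamma restricted to [0, +oo); the values of gamma on the
   negative reals are irrelevant. *)
Definition asymptotic_value (f : C -> C) (zeta : C) : Prop :=
  exists gamma : R -> C,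
    continuous_on (fun t : R => (0 <= t)%R) gamma /\
    is_lim (fun t => Cmod (gamma t)) p_infty p_infty /\
    filterlim (fun t => f (gamma t)) (Rbar_locally p_infty) (locally zeta).

Definition limit_point (S : C -> Prop) (z : C) : Prop :=
  forall U : C -> Prop, locally z U -> exists w : C, U w /\ S w /\ w <> z.

Definition closure (S : C -> Prop) (z : C) : Prop :=
  forall U : C -> Prop, locally z U -> exists w : C, U w /\ S w.

Definition bounded_set (S : C -> Prop) : Prop :=
  exists M : R, forall z : C, S z -> (Cmod z <= M)%R.

Definition singular_value (f : C -> C) (w : C) : Prop :=
  critical_value f w \/ asymptotic_value f w.

Definition sing_inv (f : C -> C) (w : C) : Prop :=
  singular_value f w \/ limit_point (singular_value f) w.

Definition class_B (f : C -> C) : Prop :=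
  transcendental_entire f /\ bounded_set (sing_inv f).

Definition postsingular_set (f : C -> C) : C -> Prop :=
  closure (fun z => exists (n : nat) (s : C), sing_inv f s /\ z = Nat.iter n f s).

Definition postsingularly_bounded (f : C -> C) : Prop :=
  bounded_set (postsingular_set f).

(* Main.v *)
Require Import Defs.
From Stdlib Require Import Lra Lia Classical ClassicalEpsilon.
Open Scope C_scope.

(** Write [L z = a z + b], so that [g = L o f^p]. Since [g] commutes with [f],
    pulling the factors [L] to the left one at a time gives
    [g^n = L^n o f^(n p)] ([iter_commuting]). As [|a| = 1] and [a <> 1], the map [L] is a
    rotation about the fixed point [b / (1 - a)], so all its iterates move the
    modulus by at most a common constant ([Cmod_iter_affine_le]). Hence the
    orbits under [g] of the singular values of [g] are bounded as soon as these
    values have the form [L (f^i sigma)] with [sigma] a singular value of [f]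
    ([singular_value_affine_iter]). The remaining points of the postsingular
    set come from continuity. Finally [f o g = a f^(p+1) + b] also commutes
    with [f], so the same argument covers it.

    The description of the singular values of [f^p] is elementary. For critical
    values it is the chain rule. Let [f^p] tend to [xi] along a curve [gamma]
    going to infinity, and put [eta = f^(p-1) o gamma]. Either [eta] goes to
    infinity, and [xi] is an asymptotic value of [f], or [eta] has a finite
    cluster point [w], and [f w = xi]. If [w] is critical, [xi] is a critical
    value of [f]. If not, [f] omits a neighbourhood of [xi] on each small
    circle around [w], so [eta] is trapped inside these circles and tends to
    [w]; then [w] is an asymptotic value of [f^(p-1)] and induction applies
    ([asymptotic_value_iter]). Once the critical case is set
    apart, [w] is isolated among the solutions of [f z = xi] simply because
    [f'(w) <> 0]. *)

(** * The modulus and the topology of the plane *)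

(** The derivative in the hypotheses uses balls of the modulus on its source,
    while closures, limit points and limits use the product topology of the
    plane; this lemma lets all of them be handled through the modulus. *)
Lemma locally_Cmod (z : C) (U : C -> Prop) :
  locally z U <->
  exists eps : R, (0 < eps)%R /\ forall y, (Cmod (y - z) < eps)%R -> U y.
Proof.
  split.
  - intros H. apply (proj1 (locally_C z U)) in H. destruct H as [e He].
    exists e. split; [apply cond_pos|]. intros y Hy. apply He. exact Hy.
  - intros [e [He H]]. apply (proj2 (locally_C z U)).
    exists (mkposreal e He). intros y Hy. apply H. exact Hy.
Qed.

Lemma Cmod_sub_sym (x y : C) : Cmod (x - y) = Cmod (y - x).
Proof. rewrite <- Cmod_opp. f_equal. ring. Qed.

Lemma Cmod_sub_triangle (x y z : C) :
  (Cmod (x - z) <= Cmod (x - y) + Cmod (y - z))%R.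
Proof. replace (x - z) with ((x - y) + (y - z)) by ring. apply Cmod_triangle. Qed.

Lemma Cmod_le_add_sub (x y : C) : (Cmod x <= Cmod y + Cmod (x - y))%R.
Proof.
  replace x with (y + (x - y)) at 1 by ring. apply Cmod_triangle.
Qed.

Lemma Cmod_sub_eq_0 (x y : C) : (Cmod (x - y) <= 0)%R -> x = y.
Proof.
  intros H. assert (E : x - y = 0).
  { apply Cmod_eq_0. generalize (Cmod_ge_0 (x - y)); lra. }
  replace x with ((x - y) + y) by ring. rewrite E. ring.
Qed.

Lemma filterlim_p_infty_Cmod (u : R -> C) (z : C) :
  filterlim u (Rbar_locally p_infty) (locally z) <->
  forall eps : R, (0 < eps)%R ->
    exists T : R, forall t, (T < t)%R -> (Cmod (u t - z) < eps)%R.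
Proof.
  split.
  - intros H eps He. apply (H (fun y => (Cmod (y - z) < eps)%R)).
    apply locally_Cmod. exists eps. split; [exact He|]. intros y Hy. exact Hy.
  - intros H P HP. apply locally_Cmod in HP. destruct HP as [e [He HP]].
    destruct (H e He) as [T HT]. exists T. intros t Ht. apply HP, HT, Ht.
Qed.

Lemma continuous_Cmod_sub (h : C -> C) (z : C) (eps : R) :
  continuous h z -> (0 < eps)%R ->
  exists d : R, (0 < d)%R /\
    forall y, (Cmod (y - z) < d)%R -> (Cmod (h y - h z) < eps)%R.
Proof.
  intros H He. apply locally_Cmod.
  apply (H (fun v => (Cmod (v - h z) < eps)%R)).
  apply locally_Cmod. exists eps. split; [exact He|]. intros y Hy. exact Hy.
Qed.

Lemma entire_continuous (f : C -> C) :
  entire f -> forall z, continuous f z.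
Proof.
  intros Hf z P HP. apply (proj2 (locally_C z _)).
  exact (ex_derive_continuous f z (Hf z) P HP).
Qed.

Lemma continuous_iter (f : C -> C) (n : nat) :
  (forall z, continuous f z) -> forall z, continuous (Nat.iter n f) z.
Proof.
  intros Hf. induction n as [|n IH]; intros z.
  - apply continuous_id.
  - exact (continuous_comp (Nat.iter n f) f z (IH z) (Hf _)).
Qed.

Lemma closure_of_mem (S : C -> Prop) (z : C) : S z -> closure S z.
Proof. intros Hz U HU. exists z. split; [exact (locally_singleton z U HU)|exact Hz]. Qed.

Lemma Cmod_le_closure (S : C -> Prop) (h : C -> C) (M : R) :
  (forall z, continuous h z) ->
  (forall z, S z -> (Cmod (h z) <= M)%R) ->
  forall z, closure S z -> (Cmod (h z) <= M)%R.
Proof.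
  intros Hh HS z Hz. apply Rnot_lt_le. intros Hlt.
  destruct (continuous_Cmod_sub h z (Cmod (h z) - M) (Hh z)) as [d [Hd Hy]];
    [lra|].
  destruct (Hz (fun y => (Cmod (y - z) < d)%R)) as [y [Hyz Sy]].
  { apply locally_Cmod. exists d. split; [exact Hd|]. intros y Hy'. exact Hy'. }
  specialize (Hy y Hyz). specialize (HS y Sy).
  generalize (Cmod_le_add_sub (h z) (h y)). rewrite (Cmod_sub_sym (h z)). lra.
Qed.

Lemma eq_on_closure (S : C -> Prop) (h k : C -> C) :
  (forall z, continuous h z) -> (forall z, continuous k z) ->
  (forall z, S z -> h z = k z) -> forall z, closure S z -> h z = k z.
Proof.
  intros Hh Hk HS z Hz. apply Cmod_sub_eq_0.
  apply (Cmod_le_closure S (fun y => h y - k y)); [| |exact Hz].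
  - intros y. exact (continuous_minus h k y (Hh y) (Hk y)).
  - intros y Sy. rewrite (HS y Sy).
    replace (k y - k y) with (RtoC 0) by ring. rewrite Cmod_0. lra.
Qed.

(** * Critical points *)

(** A form of [f'(z) <> 0] that is stable under composition without computing
    derivatives and that also isolates [z] among the solutions of
    [f y = f z]. *)
Definition expands_at (f : C -> C) (z : C) : Prop :=
  exists m : R, (0 < m)%R /\
    locally z (fun y => (m * Cmod (y - z) <= Cmod (f y - f z))%R).

Definition critical_point (f : C -> C) (z : C) : Prop :=
  is_derive (K := C_AbsRing) (V := C_NormedModule) f z (RtoC 0).

Lemma is_derive_Cmod (f : C -> C) (z l : C) (eps : R) :
  is_derive (K := C_AbsRing) (V := C_NormedModule) f z l -> (0 < eps)%R ->
  locally z (fun y =>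
    (Cmod (f y - f z - (y - z) * l) <= eps * Cmod (y - z))%R).
Proof.
  intros [_ H] He. apply (proj2 (locally_C z _)).
  exact (H z (fun P HP => HP) (mkposreal eps He)).
Qed.

(** If [f'(z) = l <> 0], the linear part [l (y - z)] dominates the remainder,
    which near [z] is at most [|l| / 2] times [|y - z|]. *)
Lemma critical_point_or_expands_at (f : C -> C) (z : C) :
  entire f -> critical_point f z \/ expands_at f z.
Proof.
  intros Hf. destruct (Hf z) as [l Hl].
  destruct (classic (l = RtoC 0)) as [E|Hl0].
  - left. red. rewrite <- E. exact Hl.
  - right. apply Cmod_gt_0 in Hl0.
    exists (Cmod l / 2)%R. split; [lra|].
    assert (H2 : (0 < Cmod l / 2)%R) by lra.
    generalize (is_derive_Cmod f z l _ Hl H2). apply filter_imp. intros y Hy.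
    generalize (Cmod_le_add_sub ((y - z) * l) (f y - f z)).
    rewrite (Cmod_sub_sym ((y - z) * l)). rewrite Cmod_mult. lra.
Qed.

Lemma critical_point_not_expands_at (f : C -> C) (z : C) :
  critical_point f z -> expands_at f z -> False.
Proof.
  intros Hc [m [Hm He]]. assert (Hm2 : (0 < m / 2)%R) by lra.
  generalize (filter_and _ _ He (is_derive_Cmod f z 0 _ Hc Hm2)).
  intros H. apply locally_Cmod in H. destruct H as [d [Hd H]].
  assert (Ed : Cmod (z + RtoC (d / 2) - z) = (d / 2)%R).
  { replace (z + RtoC (d / 2) - z) with (RtoC (d / 2)) by ring.
    rewrite Cmod_R. apply Rabs_pos_eq. lra. }
  destruct (H (z + RtoC (d / 2))) as [H1 H2].
  { rewrite Ed. lra. }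
  revert H1 H2. set (y := z + RtoC (d / 2)).
  replace (f y - f z - (y - z) * 0) with (f y - f z) by ring.
  unfold y at 1 4. rewrite Ed. intros H1 H2. nra.
Qed.

Lemma expands_at_comp (f h : C -> C) (z : C) :
  continuous h z -> expands_at h z -> expands_at f (h z) ->
  expands_at (fun y => f (h y)) z.
Proof.
  intros Hc [m [Hm H]] [k [Hk K]]. exists (k * m)%R. split; [nra|].
  generalize (filter_and _ _ H (Hc _ K)). apply filter_imp.
  intros y [H1 H2]. nra.
Qed.

(** The chain rule for [f^p]: unless some point [f^j z] with [j < p] of the orbit
    is critical, each application of [f] expands. In the first alternative
    [f^p z] is the [i]-th iterate of a critical value of [f]. *)
Lemma critical_point_or_expands_at_iter (f : C -> C) (p : nat) (z : C) :
  entire f ->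
  (exists i j, (i + S j)%nat = p /\ critical_point f (Nat.iter j f z)) \/
  expands_at (Nat.iter p f) z.
Proof.
  intros Hf. induction p as [|p IH].
  - right. exists 1%R. split; [lra|]. apply filter_forall. intros y.
    simpl. lra.
  - destruct IH as [[i [j [E Hc]]]|He].
    + left. exists (S i), j. split; [lia|exact Hc].
    + destruct (critical_point_or_expands_at f (Nat.iter p f z) Hf) as [Hc|Hx].
      * left. exists 0%nat, p. split; [lia|exact Hc].
      * right. apply (expands_at_comp f (Nat.iter p f) z); try assumption.
        apply continuous_iter, entire_continuous, Hf.
Qed.

(** * Asymptotic values *)

Definition cluster_at_infty (u : R -> C) (w : C) : Prop :=
  forall eps T : R, (0 < eps)%R ->
    exists t, (T < t)%R /\ (Cmod (u t - w) < eps)%R.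

Lemma Cmod_lt_of_box (z : C) (d : R) :
  (Rabs (fst z) < d)%R -> (Rabs (snd z) < d)%R -> (Cmod z < 2 * d)%R.
Proof.
  intros H1 H2. generalize (Cmod_2Rmax z).
  assert (Hs : (sqrt 2 <= 2)%R).
  { replace 2%R with (sqrt 4) at 2.
    - apply sqrt_le_1; lra.
    - replace 4%R with (2 * 2)%R by ring. apply sqrt_square. lra. }
  assert (H : (Rmax (Rabs (fst z)) (Rabs (snd z)) < d)%R)
    by (apply Rmax_lub_lt; assumption).
  generalize (Rabs_pos (fst z)) (Rmax_l (Rabs (fst z)) (Rabs (snd z))). nra.
Qed.

(** A curve that keeps returning to a bounded square has a cluster point there,
    by compactness. A point [w] that is not a cluster point has a [d] such that
    the curve avoids the square of half-width [d] about [w] after time [1 / d];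
    letting [d] govern both the size and the time means that the lower bound
    for the sizes in a finite cover also yields one time valid for the
    whole cover. *)
Lemma tends_to_infty_or_cluster (u : R -> C) :
  is_lim (fun t => Cmod (u t)) p_infty p_infty \/
  exists w, cluster_at_infty u w.
Proof.
  destruct (classic (exists w, cluster_at_infty u w)) as [H|Hno];
    [right; exact H|left].
  assert (Hd : forall w : C, exists d : posreal, forall t,
    (/ d < t)%R -> ~ (Rabs (fst w - fst (u t)) < d /\
                      Rabs (snd w - snd (u t)) < d)%R).
  { intros w. apply NNPP. intros Hn. apply Hno. exists w. intros eps T He.
    set (d := Rmin (eps / 2) (/ (Rabs T + 1))).
    assert (HT : (0 < Rabs T + 1)%R) by (generalize (Rabs_pos T); lra).
    assert (Hd : (0 < d)%R).
    { apply Rmin_pos; [lra|]. apply Rinv_0_lt_compat, HT. }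
    apply NNPP. intros Hn'. apply Hn. exists (mkposreal d Hd). simpl.
    intros t Ht [H1 H2]. apply Hn'. exists t. split.
    - assert (H3 : (d * (Rabs T + 1) <= 1)%R).
      { replace 1%R with (/ (Rabs T + 1) * (Rabs T + 1))%R at 2 by (field; lra).
        apply Rmult_le_compat_r; [lra|apply Rmin_r]. }
      assert (H4 : (Rabs T + 1 <= / d)%R).
      { apply (Rmult_le_reg_l d); [exact Hd|]. rewrite Rinv_r by lra.
        exact H3. }
      generalize (Rle_abs T). lra.
    - rewrite Cmod_sub_sym.
      assert (H3 := Cmod_lt_of_box (w - u t) d H1 H2).
      generalize (Rmin_l (eps / 2) (/ (Rabs T + 1))). fold d. lra. }
  set (delta := fun x y : R =>
    proj1_sig (constructive_indefinite_description _ (Hd (x, y)))).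
  assert (Hdelta : forall x y t, (/ delta x y < t)%R ->
    ~ (Rabs (x - fst (u t)) < delta x y /\
       Rabs (y - snd (u t)) < delta x y)%R).
  { intros x y.
    exact (proj2_sig (constructive_indefinite_description _ (Hd (x, y)))). }
  clearbody delta. intros P [B HB].
  destruct (compactness_value_2d (- B) B (- B) B delta) as [d Hcov].
  exists (/ d)%R. intros t Ht. apply HB. apply Rnot_le_lt. intros Hle.
  generalize (Rmax_Cmod (u t)) (Rmax_l (Rabs (fst (u t))) (Rabs (snd (u t))))
    (Rmax_r (Rabs (fst (u t))) (Rabs (snd (u t)))). intros H1 H2 H3.
  apply (Hcov (fst (u t)) (snd (u t))).
  - apply Rabs_le_between. lra.
  - apply Rabs_le_between. lra.
  - intros [x [y [_ [_ [Hx [Hy Hxy]]]]]].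
    apply (Hdelta x y t).
    + apply Rle_lt_trans with (2 := Ht). apply Rinv_le_contravar;
        [apply cond_pos|exact Hxy].
    + rewrite (Rabs_minus_sym x), (Rabs_minus_sym y). split; assumption.
Qed.

Lemma Rabs_Cmod_sub_le (x y w : C) :
  (Rabs (Cmod (x - w) - Cmod (y - w)) <= Cmod (x - y))%R.
Proof.
  apply Rabs_le. generalize (Cmod_sub_triangle x y w) (Cmod_sub_triangle y x w).
  rewrite (Cmod_sub_sym y x). lra.
Qed.

Lemma continuity_Cmod_sub (u : R -> C) (w : C) :
  (forall t, continuous u t) -> continuity (fun t => Cmod (u t - w)).
Proof.
  intros Hu t. apply continuity_pt_filterlim.
  apply filterlim_locally. intros eps.
  assert (H : locally t (fun s => (Cmod (u s - u t) < eps)%R)).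
  { apply (Hu t (fun v => (Cmod (v - u t) < eps)%R)), locally_Cmod. exists eps.
    split; [apply cond_pos|]. intros y Hy. exact Hy. }
  revert H. apply filter_imp. intros s Hs.
  apply Rle_lt_trans with (2 := Hs). apply Rabs_Cmod_sub_le.
Qed.

(** On the circle of small radius [r] about [w], [|f - f w|] is at least [m r].
    Once [f o u] is closer than that to [f w], the curve [u] can no longer cross
    this circle, and it enters the disc because it clusters at [w]. *)
Lemma cluster_limit_of_expands_at (f : C -> C) (u : R -> C) (w : C) :
  (forall t, continuous u t) ->
  cluster_at_infty u w -> expands_at f w ->
  filterlim (fun t => f (u t)) (Rbar_locally p_infty) (locally (f w)) ->
  filterlim u (Rbar_locally p_infty) (locally w).
Proof.
  intros Hu Hw [m [Hm He]] Hlim. apply locally_Cmod in He.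
  destruct He as [d [Hd He]].
  apply filterlim_p_infty_Cmod. intros eps Heps.
  set (r := Rmin eps (d / 2)).
  assert (Hr : (0 < r)%R) by (apply Rmin_pos; lra).
  assert (Hrd : (r < d)%R) by (generalize (Rmin_r eps (d / 2)); fold r; lra).
  assert (Hre : (r <= eps)%R) by (apply Rmin_l).
  assert (Hmr : (0 < m * r)%R) by nra.
  destruct (proj1 (filterlim_p_infty_Cmod _ _) Hlim (m * r)%R Hmr) as [T HT].
  assert (Hcircle : forall t, (T < t)%R -> Cmod (u t - w) <> r).
  { intros t Ht E. specialize (HT t Ht). specialize (He (u t)).
    rewrite E in He. specialize (He Hrd). lra. }
  (* a time at which the curve is inside the disc, after it stopped crossing *)
  destruct (Hw r T Hr) as [t0 [Ht0 Hin]].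
  exists t0. intros t Ht. apply Rlt_le_trans with (2 := Hre).
  apply Rnot_le_lt. intros Hge.
  destruct (IVT_gen (fun s => Cmod (u s - w)) t0 t r) as [s [Hs E]].
  - apply continuity_Cmod_sub, Hu.
  - rewrite Rmin_left, Rmax_right by lra. lra.
  - rewrite Rmin_left, Rmax_right in Hs by lra.
    apply (Hcircle s); [lra|exact E].
Qed.

Lemma limit_at_cluster (f : C -> C) (u : R -> C) (w xi : C) :
  (forall z, continuous f z) -> cluster_at_infty u w ->
  filterlim (fun t => f (u t)) (Rbar_locally p_infty) (locally xi) ->
  f w = xi.
Proof.
  intros Hf Hw Hlim. apply Cmod_sub_eq_0. apply Rnot_lt_le. intros Hlt.
  set (e := Cmod (f w - xi)) in *. assert (He : (0 < e / 2)%R) by lra.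
  destruct (continuous_Cmod_sub f w (e / 2) (Hf w) He) as [d [Hd Hy]].
  destruct (proj1 (filterlim_p_infty_Cmod _ _) Hlim _ He) as [T HT].
  destruct (Hw d T Hd) as [t [Ht Htw]].
  specialize (HT t Ht). specialize (Hy (u t) Htw).
  generalize (Cmod_sub_triangle (f w) (f (u t)) xi).
  rewrite (Cmod_sub_sym (f w) (f (u t))). fold e. lra.
Qed.

Lemma asymptotic_value_of_curve (f : C -> C) (u : R -> C) (xi : C) :
  (forall t, continuous u t) ->
  is_lim (fun t => Cmod (u t)) p_infty p_infty ->
  filterlim (fun t => f (u t)) (Rbar_locally p_infty) (locally xi) ->
  asymptotic_value f xi.
Proof.
  intros Hu Hinf Hlim. exists u. split; [|split; assumption].
  intros t _ P HP. apply filter_le_within. exact (Hu t P HP).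
Qed.

(** Induction on [q], peeling off the outermost [f]: the inner curve
    [f^q o gamma] either goes to infinity, or clusters at a critical point, or
    converges to a point to which the induction hypothesis applies. *)
Lemma asymptotic_value_iter (f : C -> C) (gamma : R -> C) (q : nat) (xi : C) :
  entire f ->
  (forall t, continuous gamma t) ->
  is_lim (fun t => Cmod (gamma t)) p_infty p_infty ->
  filterlim (fun t => Nat.iter q f (gamma t)) (Rbar_locally p_infty)
    (locally xi) ->
  exists i s, singular_value f s /\ xi = Nat.iter i f s.
Proof.
  intros Hf Hg Hinf. assert (Hfc := entire_continuous f Hf).
  revert xi. induction q as [|q IH]; intros xi Hlim.
  - exfalso. simpl in Hlim.
    destruct (proj1 (filterlim_p_infty_Cmod _ _) Hlim 1%R Rlt_0_1) as [T HT].
    destruct (Hinf (fun x => (Cmod xi + 1 < x)%R)) as [T' HT'].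
    { exists (Cmod xi + 1)%R. intros x Hx. exact Hx. }
    set (t := (Rmax T T' + 1)%R).
    assert (H1 : (T < t)%R) by (unfold t; generalize (Rmax_l T T'); lra).
    assert (H2 : (T' < t)%R) by (unfold t; generalize (Rmax_r T T'); lra).
    specialize (HT t H1). specialize (HT' t H2). simpl in HT'.
    generalize (Cmod_le_add_sub (gamma t) xi). lra.
  - set (eta := fun t => Nat.iter q f (gamma t)) in *.
    assert (Heta : forall t, continuous eta t).
    { intros t. apply (continuous_comp gamma (Nat.iter q f)); [apply Hg|].
      apply continuous_iter, Hfc. }
    destruct (tends_to_infty_or_cluster eta) as [Hi|[w Hw]].
    + exists 0%nat, xi. split; [right|reflexivity].
      exact (asymptotic_value_of_curve f eta xi Heta Hi Hlim).
    + assert (E := limit_at_cluster f eta w xi Hfc Hw Hlim).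
      destruct (critical_point_or_expands_at f w Hf) as [Hc|Hx].
      * exists 0%nat, xi. split; [left; exists w; split; assumption|reflexivity].
      * rewrite <- E in Hlim.
        destruct (IH w (cluster_limit_of_expands_at f eta w Heta Hw Hx Hlim))
          as [i [s [Hs Es]]].
        exists (S i), s. split; [exact Hs|]. rewrite <- E, Es. reflexivity.
Qed.

(** Freezing the curve at its initial point for negative times makes it
    continuous on the whole line, as the intermediate value theorem in use
    requires. *)
Lemma asymptotic_value_global_curve (h : C -> C) (zeta : C) :
  asymptotic_value h zeta ->
  exists gamma : R -> C, (forall t, continuous gamma t) /\
    is_lim (fun t => Cmod (gamma t)) p_infty p_infty /\
    filterlim (fun t => h (gamma t)) (Rbar_locally p_infty) (locally zeta).
Proof.
  intros [gamma [Hc [Hinf Hlim]]].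
  assert (Hev : Rbar_locally p_infty (fun t => gamma t = gamma (Rmax 0 t))).
  { exists 0%R. intros t Ht. rewrite Rmax_right; [reflexivity|lra]. }
  exists (fun t => gamma (Rmax 0 t)). split; [|split].
  - intros t P HP.
    destruct (Hc (Rmax 0 t) (Rmax_l 0 t) P HP) as [e He].
    exists e. intros s Hs. apply He; [|apply Rmax_l].
    (* [Rmax 0] is 1-Lipschitz, so it maps the ball into the ball. *)
    apply Rle_lt_trans with (2 := Hs).
    unfold abs, minus, plus, opp; simpl.
    unfold Rmax; destruct (Rle_dec 0 s), (Rle_dec 0 t);
      unfold Rabs; repeat destruct Rcase_abs; lra.
  - revert Hinf. apply filterlim_ext_loc. revert Hev. apply filter_imp.
    intros t E. rewrite <- E. reflexivity.
  - revert Hlim. apply filterlim_ext_loc. revert Hev. apply filter_imp.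
    intros t E. rewrite <- E. reflexivity.
Qed.

(** * Commuting functions differing by a rotation *)

Definition affine (a b z : C) : C := a * z + b.

Lemma continuous_affine (a b z : C) : continuous (affine a b) z.
Proof.
  unfold affine. apply @continuous_plus with (V := C_NormedModule).
  - apply (continuous_scal_r (V := C_NormedModule) a (fun y => y)).
    apply continuous_id.
  - apply continuous_const.
Qed.

Lemma Cmod_affine_sub (a b x y : C) :
  Cmod a = 1%R -> Cmod (affine a b x - affine a b y) = Cmod (x - y).
Proof.
  intros Ha. unfold affine.
  replace (a * x + b - (a * y + b)) with (a * (x - y)) by ring.
  rewrite Cmod_mult, Ha. ring.
Qed.

Lemma Cmod_iter_affine_le (a b : C) :
  a <> 1 -> Cmod a = 1%R ->
  exists K : R, forall n z, (Cmod (Nat.iter n (affine a b) z) <= Cmod z + K)%R.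
Proof.
  intros Ha1 Ha.
  (* The fixed point; every iterate preserves the distance to it. *)
  set (c := b / (1 - a)).
  assert (Hc : affine a b c = c).
  { unfold affine, c. field. intros E. apply Ha1.
    replace a with (1 - (1 - a)) by ring. rewrite E. ring. }
  assert (H : forall n z,
    Cmod (Nat.iter n (affine a b) z - c) = Cmod (z - c)).
  { induction n as [|n IH]; intros z; [reflexivity|].
    simpl. rewrite <- Hc at 1. rewrite Cmod_affine_sub by exact Ha. apply IH. }
  exists (2 * Cmod c)%R. intros n z.
  generalize (Cmod_le_add_sub (Nat.iter n (affine a b) z) c).
  rewrite H. generalize (Cmod_triangle z (- c)). rewrite Cmod_opp.
  unfold Cminus. lra.
Qed.

(** A critical value of [g] lies in [L (f^p (C))], but an asymptotic value may
    only lie in its closure. Recording that [xi] is in the closure of the range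
    of [f^p] treats both cases alike: identities for [g^n o L] known on that
    range extend to [xi] by continuity. *)
Lemma singular_value_affine_iter (f g : C -> C) (a b : C) (p : nat) (s : C) :
  entire f -> Cmod a = 1%R ->
  (forall z, g z = affine a b (Nat.iter p f z)) ->
  singular_value g s ->
  exists xi i sigma,
    s = affine a b xi /\ closure (fun z => exists y, z = Nat.iter p f y) xi /\
    singular_value f sigma /\ xi = Nat.iter i f sigma.
Proof.
  intros Hf Ha Hg [[w [Hw <-]]|Has].
  - exists (Nat.iter p f w).
    destruct (critical_point_or_expands_at_iter f p w Hf)
      as [[i [j [E Hc]]]|He].
    + exists i, (Nat.iter (S j) f w). repeat split.
      * apply Hg.
      * apply closure_of_mem. exists w. reflexivity.
      * left. exists (Nat.iter j f w). split; [exact Hc|reflexivity].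
      * rewrite <- E, Nat.iter_add. reflexivity.
    + exfalso. apply (critical_point_not_expands_at g w Hw).
      destruct He as [m [Hm He]]. exists m. split; [exact Hm|].
      revert He. apply filter_imp. intros y Hy.
      rewrite !Hg, Cmod_affine_sub by exact Ha. exact Hy.
  - destruct (asymptotic_value_global_curve g s Has) as [gamma [Hc [Hinf Hlim]]].
    assert (Ha0 : a <> 0).
    { intros E. rewrite E, Cmod_0 in Ha. lra. }
    set (xi := (s - b) / a).
    assert (Es : s = affine a b xi).
    { unfold affine, xi. field. exact Ha0. }
    assert (Hxi : filterlim (fun t => Nat.iter p f (gamma t))
                    (Rbar_locally p_infty) (locally xi)).
    { apply filterlim_p_infty_Cmod. intros eps He.
      destruct (proj1 (filterlim_p_infty_Cmod _ _) Hlim eps He) as [T HT].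
      exists T. intros t Ht. specialize (HT t Ht).
      rewrite Es, Hg, Cmod_affine_sub in HT by exact Ha. exact HT. }
    destruct (asymptotic_value_iter f gamma p xi Hf Hc Hinf Hxi)
      as [i [sigma [Hs Ei]]].
    exists xi, i, sigma. repeat split; trivial.
    intros U HU. destruct (Hxi U HU) as [T HT].
    exists (Nat.iter p f (gamma (T + 1)%R)).
    split; [apply HT; lra|]. exists (gamma (T + 1)%R). reflexivity.
Qed.

(** Since [g] commutes with [f^p],
    [g (g^n z) = L (f^p (g^n z)) = L (g^n (f^p z))], and induction on [n] moves
    every [L] to the left. *)
Lemma iter_commuting (f g L : C -> C) (p : nat) :
  (forall z, f (g z) = g (f z)) ->
  (forall z, g z = L (Nat.iter p f z)) ->
  forall n z, Nat.iter n g z = Nat.iter n L (Nat.iter (n * p) f z).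
Proof.
  intros Hfg Hg.
  assert (H1 : forall k z, Nat.iter k f (g z) = g (Nat.iter k f z)).
  { induction k as [|k IH]; intros z; [reflexivity|].
    simpl. rewrite IH. apply Hfg. }
  assert (H2 : forall n k z,
    Nat.iter k f (Nat.iter n g z) = Nat.iter n g (Nat.iter k f z)).
  { induction n as [|n IH]; intros k z; [reflexivity|].
    simpl. rewrite H1, IH. reflexivity. }
  induction n as [|n IH]; intros z; [reflexivity|].
  change (Nat.iter (S n) g z) with (g (Nat.iter n g z)).
  rewrite Hg, H2, IH, <- Nat.iter_add.
  replace (n * p + p)%nat with (S n * p)%nat by lia. reflexivity.
Qed.

(** With [s = L xi] a singular value of [g] and [xi = f^i sigma], the formula for
    [g^(n+1)] gives [g^n s = L^(n+1) (f^(n p + i) sigma)]. The inner point is in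
    the postsingular set of [f], and [L^(n+1)] adds at most a constant to its
    modulus. *)
Lemma postsingularly_bounded_affine_iter (f g : C -> C) (a b : C) (p : nat) :
  entire f -> (forall z, f (g z) = g (f z)) -> a <> 1 -> Cmod a = 1%R ->
  (forall z, g z = affine a b (Nat.iter p f z)) ->
  postsingularly_bounded f -> postsingularly_bounded g.
Proof.
  intros Hf Hfg Ha1 Ha Hg [M HM].
  assert (Hfc := entire_continuous f Hf).
  assert (HL : forall z, continuous (affine a b) z)
    by apply continuous_affine.
  assert (Hgc : forall z, continuous g z).
  { intros z. apply continuous_ext with (1 := fun y => eq_sym (Hg y)).
    apply (continuous_comp (Nat.iter p f) (affine a b)); [|apply HL].
    apply continuous_iter, Hfc. }
  destruct (Cmod_iter_affine_le a b Ha1 Ha) as [K HK].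
  assert (Hsing : forall n s, singular_value g s ->
    (Cmod (Nat.iter n g s) <= M + K)%R).
  { intros n s Hs.
    destruct (singular_value_affine_iter f g a b p s Hf Ha Hg Hs)
      as [xi [i [sigma [-> [Hcl [Hsigma Exi]]]]]].
    assert (E : Nat.iter n g (affine a b xi) =
      Nat.iter (S n) (affine a b) (Nat.iter (n * p) f xi)).
    { apply (eq_on_closure _ (fun z => Nat.iter n g (affine a b z))
        (fun z => Nat.iter (S n) (affine a b) (Nat.iter (n * p) f z)))
        with (4 := Hcl).
      - intros z. apply (continuous_comp (affine a b) (Nat.iter n g));
          [apply HL|apply continuous_iter, Hgc].
      - intros z.
        apply (continuous_comp (Nat.iter (n * p) f)
          (Nat.iter (S n) (affine a b))); apply continuous_iter; assumption.
      (* On the range of [f^p], [g^n (L (f^p y))] is [g^(n+1) y]. *)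
      - intros z [y ->].
        rewrite <- Hg, Nat.iter_swap.
        change (g (Nat.iter n g y)) with (Nat.iter (S n) g y).
        rewrite (iter_commuting f g (affine a b) p Hfg Hg), <- Nat.iter_add.
        replace (n * p + p)%nat with (S n * p)%nat by lia. reflexivity. }
    rewrite E. apply Rle_trans with (1 := HK _ _).
    apply Rplus_le_compat_r, HM, closure_of_mem.
    exists (n * p + i)%nat, sigma. split; [left; exact Hsigma|].
    rewrite Nat.iter_add, <- Exi. reflexivity. }
  exists (M + K)%R. apply (Cmod_le_closure _ (fun z => z)).
  - intros z. apply continuous_id.
  - intros z [n [s [Hs ->]]].
    apply (Cmod_le_closure (singular_value g) (Nat.iter n g) (M + K)%R).
    + apply continuous_iter, Hgc.
    + apply Hsing.
    + destruct Hs as [Hs|Hs]; [apply closure_of_mem, Hs|].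
      intros U HU. destruct (Hs U HU) as [w [Uw [Sw _]]].
      exists w. split; assumption.
Qed.

Theorem theorem3p6 (f g : C -> C) (a b : C) (p : nat)
  (hf : transcendental_entire f) (hg : transcendental_entire g)
  (hcomm : forall z : C, f (g z) = g (f z))
  (hp : (1 <= p)%nat)
  (ha0 : a <> RtoC 0) (ha1 : a <> RtoC 1) (ha : Cmod a = 1%R)
  (hgf : forall z : C, g z = a * Nat.iter p f z + b)
  (hB : class_B f)
  (hbdd : postsingularly_bounded f) :
  postsingularly_bounded g /\ postsingularly_bounded (fun z : C => f (g z)).
Proof.
  destruct hf as [hf _]. split.
  - exact (postsingularly_bounded_affine_iter f g a b p
      hf hcomm ha1 ha hgf hbdd).
  - apply (postsingularly_bounded_affine_iter f _ a b (S p)); trivial.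
    + intros z. rewrite !hcomm. reflexivity.
    + intros z. rewrite hcomm, hgf, Nat.iter_swap. reflexivity.
Qed.
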